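(* In the continuous network model, let $\mathcal G$ be any virtual graph and $D$ a demand matrix with $|D|=1$. If $\mathrm{mincut}_{\mathcal G}$ denotes the (size of the) minimum cut of $\mathcal G$, then any two nodes $s,e$ of $\mathcal G$ can distribute at least $\mathrm{mincut}_{\mathcal G}\cdot cap$ EPR pairs before regenerating any new entangled link.
   Context: The virtual graph $\mathcal G=(V,\mathcal E)$ is a finite connected undirected graph. Each edge $\{u,v\}\in\mathcal E$ initially carries $cap$ pre-shared entangled links (EPR pairs), $cap$ a positive integer. Distributing one EPR pair between two distinct nodes $s,e$ consumes one entangled link on each edge of some path from $s$ to $e$ in $\mathcal G$ (by entanglement swapping at the intermediate nodes, assumed deterministic); each link can be used only once. ''Before regenerating'' means using only the initially available links. $\mathrm{mincut}_{\mathcal G}$ is the minimum number of edges whose removal disconnects $\mathcal G$ (minimum edge cut). $|D|=1$ means there is only one source-destination pair $(s,e)$ with a demand. *)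

(* Defs.v *)
From mathcomp Require Import all_boot.

Set Implicit Arguments.
Unset Strict Implicit.
Unset Printing Implicit Defensive.

(* A finite simple undirected graph on V is given by its edge set E, a set of
   unordered pairs {u, v} with u != v. *)
Definition simple_graph (V : finType) (E : {set {set V}}) : bool :=
  [forall f in E, #|f| == 2].

Definition adj (V : finType) (E : {set {set V}}) : rel V :=
  fun u v => [set u; v] \in E.

Definition connected_graph (V : finType) (E : {set {set V}}) : bool :=
  [forall u, forall v, connect (adj E) u v].

Definition edge_cut (V : finType) (E F : {set {set V}}) : bool :=
  (F \subset E) && ~~ connected_graph (E :\: F).

(* When V has at least two vertices, E itself is an edge cut, so the minimum
   is over a nonempty family; on a single vertex there is no edge cut and the
   value is meaningless. *)
Definition mincut (V : finType) (E : {set {set V}}) : nat :=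
  #|[arg min_(F < E | edge_cut E F) #|F|]|.

(* D u v is the number of EPR pairs requested by source u and destination v;
   the size |D| of D is #|sd_pairs D|. *)
Definition sd_pairs (V : finType) (D : V -> V -> nat) : {set V * V} :=
  [set x | 0 < D x.1 x.2].

(* p lists the vertices after the first one, s. *)
Definition st_path (V : finType) (E : {set {set V}}) (s e : V) (p : seq V) :
    bool :=
  [&& path (adj E) s p, last s p == e & uniq (s :: p)].

Definition path_edges (V : finType) (s : V) (p : seq V) : seq {set V} :=
  pairmap (fun u v => [set u; v]) s p.

(* Number of unused entangled links on each edge. The links of a given edge are
   interchangeable, so it suffices to count them. *)
Definition links (V : finType) : Type := {set V} -> nat.

Definition initial_links (V : finType) (E : {set {set V}}) (cap : nat) :
    links V :=
  fun f => if f \in E then cap else 0.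

Definition consume (V : finType) (c : links V) (s : V) (p : seq V) : links V :=
  fun f => c f - (f \in path_edges s p).

(* [distributes E s e c n]: starting from the available links c, and without
   generating any new one, n EPR pairs can be distributed one after another
   between s and e. *)
Inductive distributes (V : finType) (E : {set {set V}}) (s e : V) :
    links V -> nat -> Prop :=
| distributes0 c : distributes E s e c 0
| distributesS c p n :
    st_path E s e p ->
    (forall f, f \in path_edges s p -> 0 < c f) ->
    distributes E s e (consume c s p) n ->
    distributes E s e c n.+1.

(* Main.v *)
Require Import Defs.
From mathcomp Require Import all_boot.
From mathcomp Require Import ssralg ssrnum ssrint zify.

Set Implicit Arguments.
Unset Strict Implicit.
Unset Printing Implicit Defensive.

(* Integral max-flow min-cut with all capacities equal to cap: the edges
   leaving a set that contains s but not e form an edge cut, so every s-e cut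
   has capacity at least mincut * cap. A flow whose value is below the capacity
   of every cut leaves e reachable from s in the residual graph, hence can be
   augmented by one unit. Conversely, a flow of value n > 0 is positive along
   some simple s-e path, and using one link on each edge of this path leaves a
   flow of value n - 1. *)

Import GRing.Theory Num.Theory.

(** Unit flow along a walk, with signs so that opposite traversals of an edge cancel: the result is
    antisymmetric, like the flows it is added to or subtracted from. *)
Fixpoint path_flow (V : eqType) (x : V) (p : seq V) (u v : V) : int :=
  if p is y :: q then
    (((u == x) && (v == y))%:Z - ((v == x) && (u == y))%:Z
      + path_flow y q u v)%R
  else 0%R.

Section PathFlow.

Variable V : finType.
Implicit Types (x u v : V) (p : seq V).

Lemma path_flow_antisym x p u v : path_flow x p u v = (- path_flow x p v u)%R.
Proof. by elim: p x => [|y q IH] x //=; rewrite IH; lia. Qed.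

Lemma path_flow_notin x p u v : u \notin x :: p -> path_flow x p u v = 0%R.
Proof.
elim: p x => [|y q IH] x //=.
rewrite inE negb_or => /andP[/negPf ux uyq]; rewrite IH // ux /=.
by move: uyq; rewrite inE negb_or => /andP[/negPf -> _]; rewrite andbF.
Qed.

(** Each step gives +1 at its tail and -1 at its head, so the contributions telescope to the two
    ends of the walk. *)
Lemma sum_path_flow x p u :
  (\sum_v path_flow x p u v)%R = ((u == x)%:Z - (u == last x p)%:Z)%R.
Proof.
have sumE (b : bool) y : (\sum_v (b && (v == y))%:Z)%R = b%:Z%R.
  rewrite (bigD1 y) //= eqxx andbT big1 ?addr0 // => v /negPf ->.
  by rewrite andbF.
elim: p x => [|y q IH] x /=; first by rewrite big1 // subrr.
rewrite big_split /= IH sumrB sumE.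
rewrite (eq_bigr (fun v => ((u == y) && (v == x))%:Z%R)); last first.
  by move=> v _; rewrite andbC.
by rewrite sumE; lia.
Qed.

Lemma path_flow_le (r : rel V) x p u v :
  path r x p -> uniq (x :: p) -> (path_flow x p u v <= (r u v)%:Z)%R.
Proof.
elim: p x => [|y q IH] x //; rewrite [path _ _ _]/= cons_uniq.
case/andP=> rxy pq /andP[xyq uq]; rewrite [path_flow _ _ _ _]/=.
have := IH y pq uq.
have [ux|] := eqVneq u x; last by lia.
have [vy|] := eqVneq v y; last by lia.
by rewrite ux vy rxy path_flow_notin //; lia.
Qed.

(** A simple path never crosses an edge back, so its contribution there cannot cancel. *)
Lemma path_flow_neq0 x p u v :
  uniq (x :: p) -> [set u; v] \in path_edges x p -> path_flow x p u v != 0%R.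
Proof.
elim: p x => [|y q IH] x //; rewrite cons_uniq => /andP[xyq uq].
rewrite /path_edges /= inE => /orP[/eqP uvxy|uvq].
  have xy : x != y by apply: contraNneq xyq => ->; rewrite mem_head.
  have uv : ((u == x) && (v == y)) || ((u == y) && (v == x)).
    have := set21 u v; have := set22 u v; rewrite uvxy !inE.
    have := set21 x y; have := set22 x y; rewrite -uvxy !inE.
    rewrite !(eq_sym x) !(eq_sym y).
    by case: (u == x); case: (v == y); case: (u == y); case: (v == x).
  case/orP: uv => /andP[/eqP-> /eqP->]; rewrite !eqxx (negPf xy) /=.
    by rewrite path_flow_notin // andbF.
  by rewrite path_flow_antisym path_flow_notin // andbF.
have nz := IH y uq uvq.
have ux : u != x.
  by apply: contraNneq nz => ->; rewrite path_flow_notin.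
have vx : v != x.
  by apply: contraNneq nz => ->; rewrite path_flow_antisym path_flow_notin.
by rewrite (negPf ux) (negPf vx) /= add0r.
Qed.

Lemma path_edgesP (r : rel V) x p f :
  path r x p -> f \in path_edges x p ->
  exists2 uv, f = [set uv.1; uv.2] & r uv.1 uv.2.
Proof.
elim: p x => [|y q IH] x //= /andP[rxy pq].
by rewrite inE => /orP[/eqP->|/IH]; [exists (x, y) | apply].
Qed.

End PathFlow.

Section Flow.

Variables (V : finType) (E : {set {set V}}) (s e : V).

(* Since f is antisymmetric, f u v is the net flow from u to v and the capacity
   bound is a bound on its absolute value. *)
Definition flow (c : links V) (f : V -> V -> int) (n : nat) : Prop :=
  [/\ forall u v, f u v = (- f v u)%R,
      forall u v, (f u v <= (c [set u; v])%:Z)%R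
    & forall u, (\sum_v f u v)%R = (n%:Z * ((u == s)%:Z - (u == e)%:Z))%R].

Definition cut_capacity (c : links V) (S : {set V}) : nat :=
  \sum_(u in S) \sum_(v in ~: S) c [set u; v].

(** Summing the net outflow over [S] leaves only the contribution of [s], and the flow inside [S]
    cancels by antisymmetry. *)
Lemma flow_across_cut c f n (S : {set V}) :
  flow c f n -> s \in S -> e \notin S ->
  (\sum_(u in S) \sum_(v in ~: S) f u v)%R = n%:Z%R.
Proof.
move=> [fN _ fsum] sS eS.
have inner : (\sum_(u in S) \sum_(v in S) f u v)%R = 0%R.
  set X := LHS; suff : X = (- X)%R by lia.
  rewrite {1}/X exchange_big /= /X -sumrN; apply: eq_bigr => u _.
  by rewrite -sumrN; apply: eq_bigr => v _.
have total : (\sum_(u in S) \sum_v f u v)%R = n%:Z%R.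
  rewrite (bigD1 s) //= fsum eqxx big1 ?addr0.
    by rewrite (negPf (memPn eS s sS)); lia.
  move=> u /andP[uS us]; rewrite fsum (negPf us) (negPf (memPn eS u uS)).
  by rewrite subrr mulr0.
rewrite -total.
transitivity (\sum_(u in S) (\sum_(v in S) f u v + \sum_(v in ~: S) f u v))%R.
  by rewrite big_split /= inner add0r.
apply: eq_bigr => u _; rewrite [RHS](bigID [in S]) /=; congr (_ + _)%R.
by apply: eq_bigl => v; rewrite inE.
Qed.

(** Otherwise the set of vertices [r]-reachable from [s] would be a cut that no [r]-step leaves, yet
    [n] units cross it. Serves both for the residual relation and for the support of the flow. *)
Lemma flow_reach (r : rel V) c f n :
  flow c f n ->
  (forall S : {set V}, s \in S -> e \notin S ->
    (forall u v, u \in S -> v \notin S -> ~~ r u v) ->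
    (\sum_(u in S) \sum_(v in ~: S) f u v)%R != n%:Z%R) ->
  exists2 p, path r s p && (last s p == e) & uniq (s :: p).
Proof.
move=> ff noS; have [/connectP[p rp ->]|nc] := boolP (connect r s e).
  by case/shortenP: rp => q rq uq _; exists q; rewrite ?rq ?eqxx.
pose S := [set u | connect r s u].
have sS : s \in S by rewrite inE.
have eS : e \notin S by rewrite inE.
have Sr u v : u \in S -> v \notin S -> ~~ r u v.
  rewrite !inE => su; apply: contra => ruv.
  exact: connect_trans su (connect1 ruv).
by case/eqP: (noS S sS eS Sr); apply: flow_across_cut ff sS eS.
Qed.

Lemma exists_flow c n :
  (forall S : {set V}, s \in S -> e \notin S -> n <= cut_capacity c S) ->
  exists f, flow c f n.
Proof.
elim: n => [_|n IH cutn].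
  by exists (fun _ _ => 0%R); split=> // u; rewrite big1 // mul0r.
have [S sS eS|f ff] := IH; first exact: ltnW (cutn S sS eS).
pose r u v := (f u v < (c [set u; v])%:Z)%R.
have [fN fc fsum] := ff.
have [|p /andP[rp /eqP pe] up] := flow_reach (r := r) ff.
  (* No residual step leaves [S], so every crossing pair is saturated and the flow across [S] is its
     capacity, at least [n.+1]. *)
  move=> S sS eS Sr.
  have -> : (\sum_(u in S) \sum_(v in ~: S) f u v)%R
            = (cut_capacity c S)%:Z%R; last by have := cutn S sS eS; lia.
  rewrite /cut_capacity -[RHS]natz natr_sum; apply: eq_bigr => u uS.
  rewrite natr_sum; apply: eq_bigr => v; rewrite inE => vS.
  by have := Sr u v uS vS; have := fc u v; rewrite /r natz; lia.
exists (fun u v => f u v + path_flow s p u v)%R; split=> [u v|u v|u].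
- by rewrite fN path_flow_antisym; lia.
- by have := path_flow_le u v rp up; have := fc u v; rewrite /r; lia.
- by rewrite big_split /= fsum sum_path_flow pe; lia.
Qed.

Lemma flow_distributes c f n :
  (forall g, 0 < c g -> g \in E) -> flow c f n ->
  distributes E s e c n.
Proof.
elim: n c f => [|n IH] c f cE ff; first exact: distributes0.
pose r u v := (0 < f u v)%R.
have [fN fc fsum] := ff.
have [|p /andP[rp /eqP pe] up] := flow_reach (r := r) ff.
  move=> S _ _ Sr; suff : (\sum_(u in S) \sum_(v in ~: S) f u v <= 0)%R by lia.
  apply: sumr_le0 => u uS; apply: sumr_le0 => v; rewrite inE => vS.
  by have := Sr u v uS vS; rewrite /r; lia.
have rc u v : r u v -> 0 < c [set u; v] by have := fc u v; rewrite /r; lia.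
apply: (@distributesS _ _ _ _ _ p).
- rewrite /st_path pe eqxx up !andbT; apply: sub_path rp => u v /rc.
  exact: cE.
- by move=> g /(path_edgesP rp)[[u v] -> /rc].
- apply: (IH _ (fun u v => f u v - path_flow s p u v)%R) => [g|].
    by rewrite /consume => cg; apply: cE; lia.
  split=> [u v|u v|u].
  + by rewrite fN path_flow_antisym; lia.
  (* On a path edge the capacity drops by one. Along the path the flow drops as well; against it the
     flow was negative, so it stays at most 0 after gaining one. *)
  + have := path_flow_le u v rp up; have := path_flow_le v u rp up.
    have := fc u v; have := fc v u; rewrite /r /consume (setUC [set v]).
    have := fN u v; have := path_flow_antisym s p u v.
    have [/(path_flow_neq0 up)|_] := boolP ([set u; v] \in path_edges s p); lia.
  + by rewrite sumrB fsum sum_path_flow pe; lia.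
Qed.

(** Once the crossing edges are removed, a walk starting in [S] stays in [S] and misses [e]. *)
Lemma edge_cut_crossing (S : {set V}) :
  s \in S -> e \notin S ->
  edge_cut E [set [set uv.1; uv.2] | uv in setX S (~: S)
                & [set uv.1; uv.2] \in E].
Proof.
move=> sS eS; apply/andP; split.
  by apply/subsetP=> g /imsetP[uv]; rewrite !inE => /andP[_ ?] ->.
set F := imset _ _; apply/negP => /forallP/(_ s)/forallP/(_ e)/connectP[p].
have Sstep u v : adj (E :\: F) u v -> u \in S -> v \in S.
  rewrite /adj inE => /andP[uvF uvE] uS; apply: contraR uvF => vS.
  by apply/imsetP; exists (u, v); rewrite ?inE //= uS vS.
elim: p s sS => [|y q IH] x xS /=; first by move=> _ ex; rewrite ex xS in eS.
by case/andP=> /Sstep/(_ xS) yS; apply: IH.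
Qed.

Lemma mincut_le_cut_capacity cap (S : {set V}) :
  s \in S -> e \notin S ->
  mincut E * cap <= cut_capacity (initial_links E cap) S.
Proof.
move=> sS eS; have cutF := edge_cut_crossing sS eS.
set F := imset _ _ in cutF.
(* The default [E] of the arg min must itself be a cut for the minimum to be meaningful. *)
have cutE : edge_cut E E.
  rewrite /edge_cut subxx setDv; apply/negP => /forallP/(_ s)/forallP/(_ e).
  case/connectP=> -[|y q] /=; first by move=> _ es; rewrite es sS in eS.
  by rewrite /adj inE.
have leF : mincut E <= #|F|.
  by rewrite /mincut; case: arg_minnP => // G _; apply.
apply: leq_trans (leq_mul leF (leqnn cap)) _.
rewrite /cut_capacity pair_big_dep /=.
(* Every crossing edge comes from a crossing ordered pair, so there are at most as many edges as
   pairs, each pair contributing [cap]. *)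
apply: leq_trans (leq_mul (leq_imset_card _ _) (leqnn cap)) _.
rewrite -sum_nat_const big_mkcond [leqRHS]big_mkcond /=.
apply: leq_sum => -[u v] _; rewrite !inE /= /initial_links.
by case: (u \in S); case: (v \in S); case: ifP.
Qed.

End Flow.

Theorem lemma2 (V : finType) (E : {set {set V}}) (cap : nat)
    (D : V -> V -> nat) (s e : V)
    (hE : simple_graph E) (hconn : connected_graph E)
    (hcap : 0 < cap)
    (hD : #|sd_pairs D| = 1)
    (hse : s != e) (hDse : (s, e) \in sd_pairs D) :
  exists2 n, mincut E * cap <= n & distributes E s e (initial_links E cap) n.
Proof.
exists (mincut E * cap) => //.
have [S sS eS|f ff] :=
  @exists_flow V s e (initial_links E cap) (mincut E * cap).
  exact: mincut_le_cut_capacity sS eS.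
apply: flow_distributes ff => // g.
by rewrite /initial_links; case: ifP.
Qed.
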